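(* Let $\Gamma=\mathrm{Cay}(\mathbb{Z}_n,S)$ be a connected $|S|$-regular graph, where $|S|$ is odd, $|S|\geq3$ and $n$ is even. Suppose that there exist elements $x^t,x^r\in S$ such that $t$ is odd and $r$ is even. Then $\Gamma$ contains no $(0,|S|)$-regular set.
   Context: $\mathbb{Z}_n=\langle x\rangle$ denotes the cyclic group of order $n$, written multiplicatively, with identity $e$, and $S\subseteq\mathbb{Z}_n\setminus\{e\}$ is inverse-closed. The Cayley graph $\mathrm{Cay}(\mathbb{Z}_n,S)$ is the simple graph with vertex set $\mathbb{Z}_n$ in which $y$ and $z$ are adjacent if and only if $y^{-1}z\in S$. For a graph $\Gamma$ and nonnegative integers $a,b$, a nonempty proper subset $C$ of $V(\Gamma)$ is an $(a,b)$-regular set of $\Gamma$ if every vertex in $C$ has exactly $a$ neighbours in $C$ and every vertex in $V(\Gamma)\setminus C$ has exactly $b$ neighbours in $C$. *)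

(* Defs.v *)
From mathcomp Require Import all_boot all_fingroup.

Set Implicit Arguments.
Unset Strict Implicit.
Unset Printing Implicit Defensive.

Local Open Scope group_scope.

(* A graph on a finite vertex type T is given by its adjacency relation.      *)

Definition nbrs_in (T : finType) (e : rel T) (v : T) (C : {set T}) : {set T} :=
  [set w in C | e v w].

Definition regular_graph (T : finType) (e : rel T) (k : nat) : Prop :=
  forall v : T, #|nbrs_in e v [set: T]| = k.

Definition connected_graph (T : finType) (e : rel T) : Prop :=
  forall v w : T, connect e v w.

Definition regular_set (T : finType) (e : rel T) (a b : nat) (C : {set T}) :
    Prop :=
  [/\ C != set0,
      C \proper [set: T],
      forall v : T, v \in C -> #|nbrs_in e v C| = a
    & forall v : T, v \notin C -> #|nbrs_in e v C| = b].

(* This is symmetric when S is inverse-closed and irreflexive when 1 is not   *)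
(* in S; both conditions on S are left to the theorems that use it.           *)
Definition Cay (gT : finGroupType) (S : {set gT}) : rel gT :=
  fun y z => y^-1 * z \in S.

Definition inverse_closed (gT : finGroupType) (S : {set gT}) : Prop :=
  forall s : gT, s \in S -> s^-1 \in S.

(* Main.v *)
Require Import Defs.
From mathcomp Require Import all_boot all_fingroup.

Set Implicit Arguments.
Unset Strict Implicit.
Unset Printing Implicit Defensive.

Local Open Scope group_scope.

(** A [(0, |S|)]-regular set [C] and its complement are the two sides of a
    bipartition of the Cayley graph: right translation by any [s] in [S]
    exchanges [C] and its complement ([regular_set_flip]). Since the graph is
    connected, the generator [x] is a product of elements of [S], so right
    translation by [x] either preserves [C] or exchanges it with its complement
    ([connect_translation]). In both cases an even power of [x] preserves [C]
    ([translation_expg]). An element of [S] that is an even power of [x] would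
    therefore both preserve [C] and exchange it with its complement. *)

(** The boolean [b] records whether right translation by [g] exchanges [C] with
    its complement; composing translations adds these booleans modulo 2. *)
Definition translates_by (gT : finGroupType) (C : {set gT}) (b : bool)
    (g : gT) : Prop :=
  forall v : gT, (v * g \in C) = (v \in C) (+) b.

Lemma translation1 (gT : finGroupType) (C : {set gT}) :
  translates_by C false 1.
Proof. by move=> v; rewrite mulg1 addbF. Qed.

Lemma translationM (gT : finGroupType) (C : {set gT}) (b c : bool) (g h : gT) :
  translates_by C b g -> translates_by C c h -> translates_by C (b (+) c) (g * h).
Proof. by move=> Hg Hh v; rewrite mulgA Hh Hg addbA. Qed.

Lemma translation_expg (gT : finGroupType) (C : {set gT}) (b : bool) (g : gT)
    (k : nat) :
  translates_by C b g -> translates_by C (odd k && b) (g ^+ k).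
Proof.
move=> Hg; elim: k => [|k IHk]; first exact: translation1.
have -> : odd k.+1 && b = b (+) (odd k && b) by rewrite /=; case: b (odd k) {Hg IHk} => [] [].
by rewrite expgS; apply: translationM.
Qed.

(** A vertex outside [C] has all its [|S|] neighbours in [C], because its
    neighbours form the coset [v *: S], which has only [|S|] elements. *)
Lemma regular_set_flip (gT : finGroupType) (S C : {set gT}) (s : gT) :
  regular_set (Cay S) 0 #|S| C -> s \in S -> translates_by C true s.
Proof.
case=> _ _ C_in C_out Ss v; rewrite addbT.
have [Cv | nCv] := boolP (v \in C).
  apply/negP => Cvs; have /eqP := C_in v Cv.
  by rewrite cards_eq0 => /eqP/setP/(_ (v * s)); rewrite !inE Cvs /Cay mulKg Ss.
have sub : nbrs_in (Cay S) v C \subset v *: S.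
  by apply/subsetP => w; rewrite inE mem_lcoset => /andP[].
have /eqP/setP/(_ (v * s)) : nbrs_in (Cay S) v C == v *: S.
  by rewrite eqEcard sub card_lcoset C_out /=.
by rewrite inE mem_lcoset /Cay mulKg Ss andbT.
Qed.

(** Each edge of a path multiplies on the right by an element of [S]. *)
Lemma connect_translation (gT : finGroupType) (S C : {set gT}) (y z : gT) :
    (forall s, s \in S -> translates_by C true s) ->
    connect (Cay S) y z ->
  exists b : bool, translates_by C b (y^-1 * z).
Proof.
move=> flip /connectP[p]; elim: p y => [|w p IHp] y /= => [_ -> | /andP[yw wp] z_last].
  by exists false; rewrite mulVg; apply: translation1.
have [b Hb] := IHp w wp z_last.
exists (true (+) b); have -> : y^-1 * z = (y^-1 * w) * (w^-1 * z).
  by rewrite -mulgA mulKVg.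
by apply: translationM Hb; apply: flip.
Qed.

Theorem theorem4p7 (gT : finGroupType) (n : nat) (x : gT) (S : {set gT})
    (Zn_gen : [set: gT] = <[x]>) (Zn_card : #|[set: gT]| = n)
    (S_no1 : 1 \notin S) (S_inv : inverse_closed S)
    (Gamma_conn : connected_graph (Cay S))
    (Gamma_reg : regular_graph (Cay S) #|S|)
    (S_odd : odd #|S|) (S_ge3 : (3 <= #|S|)%N) (n_even : ~~ odd n)
    (S_tr : exists t r : nat,
       [/\ x ^+ t \in S, x ^+ r \in S, odd t & ~~ odd r]) :
  ~ exists C : {set gT}, regular_set (Cay S) 0 #|S| C.
Proof.
case=> C C_reg; case: S_tr => t [r [_ Sxr _ r_even]].
have flip s := @regular_set_flip gT S C s C_reg.
have [b] := connect_translation flip (Gamma_conn 1 x).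
rewrite invg1 mul1g => /(translation_expg r)/(_ 1).
by rewrite (negbTE r_even) (flip _ Sxr) addbF addbT; case: (1 \in C).
Qed.
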